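(* Let $q \in \{1,2\}$. Suppose we are given a Robust $k$-Median ($q=1$) or Robust $k$-Means ($q=2$) instance $\mathcal{I} = (F, C, d, k, m)$, parameters $\rho, \delta \in (0, 1/2)$, and an upper bound $U$ on the cost of an optimal solution $(S^*, C^* )$ to $\mathcal{I}$ (the solution $(S^*,C^* )$ is not given). Then there is an $n^{O(1/\rho)}$-time algorithm that outputs $n^{O(1/\rho)}$ many extended instances such that one of them, say $\mathcal{I}'$, has the form $(F, C', d, k, m', S_0)$ with $C' \subseteq C$, $m' = |C^* \cap C'|$ and $S_0 \subseteq S^*$, and satisfies: (a) $\mathcal{I}'$ is $(\rho, \delta, U)$-sparse with respect to the solution $(S^*, C^* \cap C')$; (b) $\frac{(1-\delta)^q}{(1+\delta)^q}\sum_{j \in C^* \setminus C'} d^q(j, S_0) + \sum_{j \in C^* \cap C'} d^q(j, S^* ) \leq U$.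
   Context: An instance $(F,C,d,k,m)$ consists of finite sets $C$ (clients) and $F$ (facilities), a metric $d$ on $F \cup C$, and integers $k,m$. A solution is a pair $(S, C^* )$ with $S \subseteq F$, $|S| \leq k$, $C^* \subseteq C$, $|C^*| \geq m$, and cost $\sum_{j \in C^*} d^q(j,S)$, where $d(j,S) = \min_{i\in S} d(j,i)$; $q=1$ for Robust $k$-Median and $q=2$ for Robust $k$-Means. An extended instance $(F, C, d, k, m, S_0)$ additionally has $S_0 \subseteq F$, and a solution $(S, C^* )$ must additionally satisfy $S_0 \subseteq S$. For a set $P$, point $p$ and $r \in \mathbb{R}$, $\mathrm{Ball}_P(p,r) = \{p' \in P : d(p,p') \leq r\}$. For $S^* \subseteq F$, the nearest-facility-vector-pair $(\kappa^*, c^* )$ is defined by $\kappa^*_p = \arg\min_{i \in S^*} d(i,p)$ and $c^*_p = \min_{i\in S^*} d(i,p)$ for $p \in F \cup C$. Sparsity: given an extended instance $\mathcal{I}' = (F, C', d, k, m', S_0)$, parameters $\rho,\delta \in (0,1/2)$, $U \geq 0$, and a solution $(S^*, C'^* )$ of $\mathcal{I}'$ with cost at most $U$ and nearest-facility-vector-pair $(\kappa^*, c^* )$, $\mathcal{I}'$ is $(\rho,\delta,U)$-sparse w.r.t. $(S^*, C'^* )$ if (i) for every $i \in S^* \setminus S_0$, $\sum_{j \in C'^*: \kappa^*_j = i} (c^*_j)^q \leq \rho U$, and (ii) for every $p \in F \cup C'$, $|\mathrm{Ball}_{C'^*}(p, \delta c^*_p)| \cdot (c^*_p)^q \leq \rho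 U$. Here $n$ is the input size. *)

(* Defs.v *)
From HB Require Import structures.
From mathcomp Require Import all_boot all_order all_algebra.
From mathcomp Require Import all_classical all_reals all_analysis.
Set Implicit Arguments.
Unset Strict Implicit.
Unset Printing Implicit Defensive.
Import Order.TTheory GRing.Theory Num.Theory.
Local Open Scope ring_scope.

(* Facilities and clients may overlap. All points live in a finite type T;
   the metric is only constrained on [fac :|: cli]. *)
Record instance (R : realType) (T : finType) := Instance {
  fac : {set T};
  cli : {set T};
  dst : T -> T -> R;
  kay : int;
  emm : int
}.

Record ext_instance (R : realType) (T : finType) := ExtInstance {
  base :> instance R T;
  forced : {set T}   (* S_0 *)
}.

Definition metric_on (R : realType) (T : finType) (D : {set T})
    (d : T -> T -> R) : Prop :=
  [/\ {in D &, forall x y, 0 <= d x y},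
      {in D &, forall x y, d x y = 0 <-> x = y},
      {in D &, forall x y, d x y = d y x}
    & {in D & &, forall x y z, d x z <= d x y + d y z}].

Definition wf_instance (R : realType) (T : finType) (I : instance R T) : Prop :=
  metric_on (fac I :|: cli I) (dst I).

Definition wf_ext (R : realType) (T : finType) (J : ext_instance R T) : Prop :=
  wf_instance J /\ forced J \subset fac J.

(* The minimum over the empty set is +oo, so costs are extended reals:
   a nonempty set of clients cannot be served by an empty set of facilities. *)
Definition dist (R : realType) (T : finType) (d : T -> T -> R)
    (j : T) (S : {set T}) : \bar R :=
  \big[mine/+oo%E]_(i in S) (d j i)%:E.

Definition solution (R : realType) (T : finType) (I : instance R T)
    (S Cs : {set T}) : Prop :=
  [/\ S \subset fac I, (#|S|%:Z <= kay I), Cs \subset cli I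
    & (emm I <= #|Cs|%:Z)].

Definition ext_solution (R : realType) (T : finType) (J : ext_instance R T)
    (S Cs : {set T}) : Prop :=
  solution J S Cs /\ forced J \subset S.

Definition cost (R : realType) (T : finType) (q : nat) (I : instance R T)
    (S Cs : {set T}) : \bar R :=
  (\sum_(j in Cs) dist (dst I) j S ^+ q)%E.

Definition optimal (R : realType) (T : finType) (q : nat) (I : instance R T)
    (S Cs : {set T}) : Prop :=
  solution I S Cs /\
  forall S' Cs', solution I S' Cs' -> (cost q I S Cs <= cost q I S' Cs')%E.

Definition ball_in (R : realType) (T : finType) (d : T -> T -> R)
    (P : {set T}) (p : T) (r : \bar R) : {set T} :=
  [set p' in P | ((d p p')%:E <= r)%E]%SET.

(* [kappa] may break ties of the argmin arbitrarily; it is unconstrained when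
   S is empty, in which case c is +oo. *)
Definition nearest_pair (R : realType) (T : finType) (d : T -> T -> R)
    (D S : {set T}) (kappa : T -> T) (c : T -> \bar R) : Prop :=
  {in D, forall p,
    (S != finset.set0 -> kappa p \in S /\ {in S, forall i, d (kappa p) p <= d i p}) /\
    c p = \big[mine/+oo%E]_(i in S) (d i p)%:E}.

Definition sparse (R : realType) (T : finType) (q : nat)
    (J : ext_instance R T) (rho delta U : R) (S Cs : {set T})
    (kappa : T -> T) (c : T -> \bar R) : Prop :=
  [/\ ext_solution J S Cs,
      (cost q J S Cs <= U%:E)%E,
      nearest_pair (dst J) (fac J :|: cli J) S kappa c,
      {in S :\: forced J, forall i,
        (\sum_(j in Cs | kappa j == i) c j ^+ q <= (rho * U)%:E)%E}
    & {in fac J :|: cli J, forall p,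
        ((#|ball_in (dst J) Cs p (delta%:E * c p)|%:R)%:E * c p ^+ q
          <= (rho * U)%:E)%E}].

(* Model of computation

   A first-order functional language on binary trees whose leaves are nil or
   real numbers (pure LISP with real atoms, i.e. a tree version of the
   Blum-Shub-Smale / real-RAM model). A program is a finite list of
   unary, mutually recursive function bodies over de Bruijn variables; it does
   not mention R, and its only constants are natural numbers. Every evaluation
   rule costs one unit of time on top of its premises, and a tree is passed and
   copied by reference. Reals can only be combined by field operations and
   compared: there is no rounding, and no equality test on trees. *)

Inductive value (R : Type) : Type :=
  | VNil
  | VReal of R
  | VCons of value R & value R.
Arguments VNil {R}.

Inductive arith := Add | Sub | Mul | Div.

Inductive expr : Type :=
  | EVar of nat
  | ELet of expr & expr                  (* binds variable 0 in the body *)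
  | ENil
  | ECons of expr & expr
  | EMatch of expr & expr & expr         (* nil branch; cons branch, which
                                            binds head = 0 and tail = 1 *)
  | ENum of nat
  | EArith of arith & expr & expr
  | EIfLe of expr & expr & expr & expr   (* if e1 <= e2 then e3 else e4 *)
  | ECall of nat & expr.

Definition program := seq expr.

Definition arith_sem (R : realType) (o : arith) (x y : R) : option R :=
  match o with
  | Add => Some (x + y)
  | Sub => Some (x - y)
  | Mul => Some (x * y)
  | Div => if y == 0 then None else Some (x / y)
  end.

(* [eval P env e v t]: in environment env, e evaluates to v in time t. There is
   no rule for ill-formed situations (unbound variable or function, wrong kind
   of tree, division by zero): evaluation is then stuck. *)
Inductive eval (R : realType) (P : program) :
    seq (value R) -> expr -> value R -> nat -> Prop :=
  | eval_var env i v : onth env i = Some v ->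
      eval P env (EVar i) v 1
  | eval_let env e1 e2 v1 v2 t1 t2 :
      eval P env e1 v1 t1 -> eval P (v1 :: env) e2 v2 t2 ->
      eval P env (ELet e1 e2) v2 (t1 + t2).+1
  | eval_nil env : eval P env ENil VNil 1
  | eval_cons env e1 e2 v1 v2 t1 t2 :
      eval P env e1 v1 t1 -> eval P env e2 v2 t2 ->
      eval P env (ECons e1 e2) (VCons v1 v2) (t1 + t2).+1
  | eval_match_nil env e en ec v t1 t2 :
      eval P env e VNil t1 -> eval P env en v t2 ->
      eval P env (EMatch e en ec) v (t1 + t2).+1
  | eval_match_cons env e en ec a b v t1 t2 :
      eval P env e (VCons a b) t1 -> eval P (a :: b :: env) ec v t2 ->
      eval P env (EMatch e en ec) v (t1 + t2).+1
  | eval_num env n : eval P env (ENum n) (VReal (n%:R : R)) 1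
  | eval_arith env o e1 e2 x y z t1 t2 :
      eval P env e1 (VReal x) t1 -> eval P env e2 (VReal y) t2 ->
      arith_sem o x y = Some z ->
      eval P env (EArith o e1 e2) (VReal z) (t1 + t2).+1
  | eval_ifle env e1 e2 e3 e4 x y v t1 t2 t3 :
      eval P env e1 (VReal x) t1 -> eval P env e2 (VReal y) t2 ->
      eval P env (if x <= y then e3 else e4) v t3 ->
      eval P env (EIfLe e1 e2 e3 e4) v (t1 + t2 + t3).+1
  | eval_call env f e body a v t1 t2 :
      eval P env e a t1 -> onth P f = Some body -> eval P [:: a] body v t2 ->
      eval P env (ECall f e) v (t1 + t2).+1.

(* The main function is function 0. *)
Definition runs_in (R : realType) (P : program) (input output : value R)
    (t : nat) : Prop :=
  eval P [:: input] (ECall 0 (EVar 0)) output t.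

Lemma eval_det (R : realType) (P : program) (env : seq (value R)) (e : expr)
    (v v' : value R) (t t' : nat) :
  eval P env e v t -> eval P env e v' t' -> v = v' /\ t = t'.
Proof.
move=> H; move: v' t'; induction H => v' t' H'; inversion H'; subst;
  repeat match goal with
  | H1 : onth ?P ?f = Some ?x, H2 : onth ?P ?f = Some ?y |- _ =>
      rewrite H1 in H2; injection H2; intros; clear H2; subst
  | IH : (forall v' t', eval P ?env ?e v' t' -> _), He : eval P ?env ?e _ _ |- _ =>
      let E := fresh in
      have [E ?] := IH _ _ He; clear IH; try discriminate E;
      try (injection E; intros); subst
  end; split=> //; congruence.
Qed.

Fixpoint vsize (R : Type) (v : value R) : nat :=
  match v with
  | VCons a b => (vsize a + vsize b).+1
  | _ => 1%N
  end.

Definition enc_list (R : Type) (s : seq (value R)) : value R :=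
  foldr (@VCons R) VNil s.

Definition enc_bool (R : Type) (b : bool) : value R :=
  if b then VCons VNil VNil else VNil.

(* Points are identified by their position in [enum T]; a set is the list of
   its membership bits. *)
Definition enc_set (R : Type) (T : finType) (A : {set T}) : value R :=
  enc_list [seq enc_bool R (x \in A) | x <- enum T].

Definition enc_dst (R : Type) (T : finType) (d : T -> T -> R) : value R :=
  enc_list [seq enc_list [seq VReal (d x y) | y <- enum T] | x <- enum T].

Definition inst_fields (R : realType) (T : finType) (I : instance R T) :
    seq (value R) :=
  [:: enc_set R (fac I); enc_set R (cli I); enc_dst (dst I);
      VReal (kay I)%:~R; VReal (emm I)%:~R].

Definition enc_input (R : realType) (T : finType) (I : instance R T)
    (rho delta U : R) : value R :=
  enc_list [:: enc_list (inst_fields I); VReal rho; VReal delta; VReal U].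

Definition enc_ext (R : realType) (T : finType) (J : ext_instance R T) :
    value R :=
  enc_list (rcons (inst_fields J) (enc_set R (forced J))).

Definition enc_output (R : realType) (T : finType)
    (L : seq (ext_instance R T)) : value R :=
  enc_list [seq enc_ext J | J <- L].

(* Main.v *)
(** A step of the guessing process picks a point [p] and a facility [i], puts
    [i] into [S_0] and deletes [Ball(p, delta d(p, i))] from [C'].  If the
    instance is not yet sparse with respect to an optimal solution with
    connection distances [c] and nearest facilities [kappa], then for a suitable
    [p] the step [(p, kappa p)] lowers the potential
      [sum_(j in Cs, j in C') c_j^q + sum_(j in Cs, kappa_j notin S_0) c_j^q]
    by more than [rho U / 4]: for a heavy star take [p = i] (the ball is then a
    single point), and for a dense ball every deleted client [j] has
    [c_j >= (1 - delta) c_p >= c_p / 2].  The potential starts below [2 U], so at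
    most [8 / rho] steps are needed, and enumerating all sequences of steps
    together with all values of [m'] gives [n^O(1/rho)] instances.  A deleted
    client satisfies [d(j, kappa p) <= (1 + delta) c_p <=
    (1 + delta) / (1 - delta) c_j], whence (b). *)
Require Import Defs.
From Stdlib Require List.
From mathcomp Require Import all_boot all_order all_algebra.
From mathcomp Require Import all_classical all_reals all_analysis.
From mathcomp Require Import zify lra.
Import Order.TTheory GRing.Theory Num.Theory.
Local Open Scope ring_scope.
Set Implicit Arguments.
Unset Strict Implicit.

(** * The program *)

(* Body of function [f], a right fold over the argument [(list, (start, ctx))].
   In [e], variable 0 is the accumulated value, 1 the current element and 4 the
   context. *)
Definition fold_expr (f : nat) (e : expr) : expr :=
  EMatch (EVar 0) ENil (EMatch (EVar 1) ENil (EMatch (EVar 2) (EVar 0)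
    (ELet (ECall f (ECons (EVar 1) (EVar 5))) e))).

Definition zip_call (A B : expr) : expr := ECall 2 (ECons A B).

Definition prune_call (A row r : expr) : expr :=
  ECall 3 (ECons (zip_call A row) (ECons ENil r)).

(* The counter starts at 8 and loses [rho] in each round, which makes
   [ceil(8 / rho)] rounds without any rounding operation. *)
Definition iter_body : expr :=
  EMatch (EVar 0) ENil (EMatch (EVar 1) ENil (EMatch (EVar 1) ENil
    (EIfLe (EVar 4) (ENum 0) (EVar 0)
      (ECall 1 (ECons (EArith Defs.Sub (EVar 4) (EVar 2)) (ECons (EVar 2)
        (ECons (ECall 7 (ECons (EVar 0) (ECons ENil (EVar 1))))
          (EVar 1)))))))).

Definition zip_body : expr :=
  EMatch (EVar 0) ENil (EMatch (EVar 0) ENil (EMatch (EVar 3) ENil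
    (ECons (ECons (EVar 2) (EVar 0))
      (zip_call (EVar 3) (EVar 1))))).

Definition prune_step : expr :=
  EMatch (EVar 1) ENil
    (ECons (EIfLe (EVar 1) (EVar 6) ENil (EVar 0)) (EVar 2)).

Definition diff_step : expr :=
  EMatch (EVar 1) ENil (ECons (EMatch (EVar 1) (EVar 0) ENil) (EVar 2)).

(** Innermost of three nested loops, over states, centres and facilities, which push onto one shared
    accumulator. The context carries the row of the centre, [delta] and the state. *)
Definition facility_step : expr :=
  EMatch (EVar 1) ENil (EMatch (EVar 6) ENil (EMatch (EVar 1) ENil
    (EMatch (EVar 1) ENil
      (ECons (ECons (prune_call (EVar 0) (EVar 4) (EArith Mul (EVar 2) (EVar 7)))
                    (prune_call (EVar 1) (EVar 6) (ENum 0)))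
             (EVar 8))))).

Definition centre_step : expr :=
  EMatch (EVar 4) ENil
    (ECall 5 (ECons (zip_call (EVar 0) (EVar 3))
      (ECons (EVar 2) (ECons (EVar 3) (EVar 1))))).

Definition state_step : expr :=
  EMatch (EVar 4) ENil
    (ECall 6 (ECons (EVar 0) (ECons (ECons (EVar 3) (EVar 2))
      (ECons (EVar 0) (ECons (EVar 1) (EVar 3)))))).

Definition count_step : expr :=
  EMatch (EVar 0) ENil (EMatch (EVar 6) ENil (EMatch (EVar 1) ENil
    (EMatch (EVar 1) ENil (EMatch (EVar 1) ENil (EMatch (EVar 1) ENil
      (EMatch (EVar 1) ENil
        (ECons (EArith Add (EVar 12) (ENum 1))
          (ECons
            (ECons (EVar 6) (ECons (EVar 10) (ECons (EVar 2) (ECons (EVar 0)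
              (ECons (EVar 12) (ECons (EVar 8) ENil))))))
            (EVar 13))))))))).

(* Counting along [nil :: C'], a list of length [#|T| + 1], yields the guesses
   0, ..., #|T| for m'. *)
Definition emit_step : expr :=
  EMatch (EVar 1) ENil (EMatch (EVar 6) ENil
    (EMatch
      (ECall 8 (ECons (ECons ENil (EVar 2))
        (ECons (ECons (ENum 0) (EVar 4))
          (ECons (EVar 2)
            (ECons (ECall 4 (ECons (zip_call (EVar 0) (EVar 3))
                                   (ECons ENil ENil)))
              (EVar 8))))))
      ENil (EVar 1))).

Definition main_body : expr :=
  EMatch (EVar 0) ENil (EMatch (EVar 1) ENil (EMatch (EVar 1) ENil
    (EMatch (EVar 4) ENil (EMatch (EVar 1) ENil (EMatch (EVar 1) ENil
      (ECall 9 (ECons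
        (ECall 1 (ECons (ENum 8) (ECons (EVar 8)
          (ECons (ECons (ECons (EVar 2) (EVar 4)) ENil)
            (ECons (EVar 0) (EVar 6))))))
        (ECons ENil (EVar 10))))))))).

Definition prog : program :=
  [:: main_body; iter_body; zip_body; fold_expr 3 prune_step;
      fold_expr 4 diff_step; fold_expr 5 facility_step;
      fold_expr 6 centre_step; fold_expr 7 state_step;
      fold_expr 8 count_step; fold_expr 9 emit_step].

(** * Evaluation with upper bounds on the running time *)

Section Program.
Variables (R : realType).
Implicit Types (env : seq (value R)) (v : value R).

(** An upper bound instead of the exact time lets every cost be rounded up to a simple
    expression. *)
Definition runs env e v (b : nat) : Prop :=
  exists2 t, Defs.eval prog env e v t & (t <= b)%N.

(** Applied first in evaluation proofs: value and bound become unknowns that the rules fill in, to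
    be compared with the claimed ones at the end. *)
Lemma runs_conv env e v v' b b' :
  runs env e v' b' -> v' = v -> (b' <= b)%N -> runs env e v b.
Proof. by move=> [t ev tb] <- bb; exists t => //; apply: leq_trans bb. Qed.

Lemma runs_var env i v : onth env i = Some v -> runs env (EVar i) v 1.
Proof. by move=> h; exists 1%N => //; constructor. Qed.

Lemma runs_nil env : runs env ENil VNil 1.
Proof. by exists 1%N => //; constructor. Qed.

Lemma runs_num env n : runs env (ENum n) (VReal n%:R) 1.
Proof. by exists 1%N => //; constructor. Qed.

Lemma runs_let env e1 e2 v1 v2 b1 b2 :
  runs env e1 v1 b1 -> runs (v1 :: env) e2 v2 b2 ->
  runs env (ELet e1 e2) v2 (b1 + b2).+1.
Proof.
move=> [t1 h1 l1] [t2 h2 l2]; exists (t1 + t2).+1; last by rewrite ltnS leq_add.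
exact: eval_let h1 h2.
Qed.

Lemma runs_cons env e1 e2 v1 v2 b1 b2 :
  runs env e1 v1 b1 -> runs env e2 v2 b2 ->
  runs env (ECons e1 e2) (VCons v1 v2) (b1 + b2).+1.
Proof.
move=> [t1 h1 l1] [t2 h2 l2]; exists (t1 + t2).+1; last by rewrite ltnS leq_add.
exact: eval_cons h1 h2.
Qed.

Lemma runs_match_nil env e en ec v b1 b2 :
  runs env e VNil b1 -> runs env en v b2 ->
  runs env (EMatch e en ec) v (b1 + b2).+1.
Proof.
move=> [t1 h1 l1] [t2 h2 l2]; exists (t1 + t2).+1; last by rewrite ltnS leq_add.
exact: eval_match_nil.
Qed.

Lemma runs_match env e en ec x y v b1 b2 :
  runs env e (VCons x y) b1 -> runs (x :: y :: env) ec v b2 ->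
  runs env (EMatch e en ec) v (b1 + b2).+1.
Proof.
move=> [t1 h1 l1] [t2 h2 l2]; exists (t1 + t2).+1; last by rewrite ltnS leq_add.
exact: eval_match_cons h1 h2.
Qed.

Lemma runs_arith env o e1 e2 x y z b1 b2 :
  runs env e1 (VReal x) b1 -> runs env e2 (VReal y) b2 ->
  arith_sem o x y = Some z ->
  runs env (EArith o e1 e2) (VReal z) (b1 + b2).+1.
Proof.
move=> [t1 h1 l1] [t2 h2 l2] h; exists (t1 + t2).+1.
  exact: eval_arith h1 h2 h.
by rewrite ltnS leq_add.
Qed.

Lemma runs_ifle env e1 e2 e3 e4 x y v b1 b2 b3 :
  runs env e1 (VReal x) b1 -> runs env e2 (VReal y) b2 ->
  runs env (if x <= y then e3 else e4) v b3 ->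
  runs env (EIfLe e1 e2 e3 e4) v (b1 + b2 + b3).+1.
Proof.
move=> [t1 h1 l1] [t2 h2 l2] [t3 h3 l3]; exists (t1 + t2 + t3).+1.
  exact: eval_ifle h1 h2 h3.
by rewrite ltnS !leq_add.
Qed.

Lemma runs_call env f e body a v b1 b2 :
  onth prog f = Some body -> runs env e a b1 -> runs [:: a] body v b2 ->
  runs env (ECall f e) v (b1 + b2).+1.
Proof.
move=> h [t1 h1 l1] [t2 h2 l2]; exists (t1 + t2).+1.
  exact: eval_call h1 h h2.
by rewrite ltnS leq_add.
Qed.

(** A match is stepped only when its scrutinee is a variable bound to a pair; nil branches,
    conditionals and calls are left to explicit steps. *)
Ltac runs_step := first
  [ eapply runs_var; reflexivity
  | exact: runs_nil
  | exact: runs_num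
  | eapply runs_match; [ eapply runs_var; reflexivity | ]
  | eapply runs_arith; [ | | reflexivity ]
  | eapply runs_cons ].

(** Handles the recursion once for all loops: a body is checked for a single iteration, against its
    model [g]. The constant 20 covers the matches, the call and the [let] of a round. *)
Lemma runs_fold f e (A B : Type) (ea : A -> value R) (eb : B -> value R)
    (g : A -> B -> B) (s : seq A) (z : B) ctx b :
  onth prog f = Some (fold_expr f e) ->
  (forall x y xs w l r,
    runs [:: eb y, ea x, xs, w, ctx, l & r] e (eb (g x y)) b) ->
  runs [:: VCons (enc_list (map ea s)) (VCons (eb z) ctx)] (fold_expr f e)
    (eb (foldr g z s)) (size s * (b + 20) + 20).
Proof.
move=> hf he; elim: s => [|x s IH] /=.
  eapply runs_conv.
    repeat runs_step; eapply runs_match_nil; runs_step.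
  - by [].
  - by [].
eapply runs_conv.
  repeat runs_step; eapply runs_let; last exact: (he x (foldr g z s)).
  eapply runs_call; [exact: hf | repeat runs_step | exact: IH].
- by [].
- by lia.
Qed.

Lemma runs_zip (A : Type) (f g : A -> value R) s :
  runs [:: VCons (enc_list (map f s)) (enc_list (map g s))] zip_body
   (enc_list [seq VCons (f x) (g x) | x <- s]) (size s * 20 + 20).
Proof.
elim: s => [|x s IH] /=.
  eapply runs_conv.
    runs_step; eapply runs_match_nil; runs_step.
  - by [].
  - by [].
eapply runs_conv.
  repeat runs_step.
  eapply runs_call; [reflexivity | repeat runs_step | exact: IH].
- by [].
- by lia.
Qed.

(** * Correctness and cost of the functions of the program *)

Section Instance.
Variables (T : finType) (I : instance R T) (delta : R).
Let N := #|T|.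

(* The pair (C', F \ S_0): with the complement of S_0, deleting a ball and adding
   a facility are both instances of [prune]. *)
Definition state := ({set T} * {set T})%type.

Definition prune (A : {set T}) (p : T) (r : R) : {set T} :=
  [set y in A | r < dst I p y].

Definition act (s : state) (p i : T) : state :=
  (prune s.1 p (delta * dst I p i), prune s.2 i 0).

(** Starting from [s :: acc] keeps the old state, so that sequences of fewer steps are enumerated
    too. *)
Definition extend (s : state) (acc : seq state) : seq state :=
  foldr (fun p acc => foldr (fun i => cons (act s p i)) acc (enum T))
    (s :: acc) (enum T).

Definition step (ss : seq state) : seq state := foldr extend [::] ss.

Definition ext_of (s : state) (m : nat) : ext_instance R T :=
  ExtInstance (Instance (fac I) s.1 (dst I) (kay I) m) (fac I :\: s.2).

Definition count_up (s : state) (mL : nat * seq (ext_instance R T)) :=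
  (mL.1.+1, ext_of s mL.1 :: mL.2).

Definition emit (s : state) (L : seq (ext_instance R T)) :=
  (iter #|T|.+1 (count_up s) (0%N, L)).2.

Definition enc_state (s : state) : value R :=
  VCons (enc_set R s.1) (enc_set R s.2).

Definition enc_states (ss : seq state) : value R := enc_list (map enc_state ss).

Definition row (p : T) : value R :=
  enc_list [seq VReal (dst I p y) | y <- enum T].

Lemma size_enumT : size (enum T) = N. Proof. by rewrite -cardE. Qed.

Lemma runs_zip_call (f g : T -> value R) env e1 e2 b1 b2 :
  runs env e1 (enc_list (map f (enum T))) b1 ->
  runs env e2 (enc_list (map g (enum T))) b2 ->
  runs env (zip_call e1 e2) (enc_list [seq VCons (f x) (g x) | x <- enum T])
   (b1 + b2 + N * 20 + 22).
Proof.
move=> h1 h2; eapply runs_conv.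
  eapply runs_call; [reflexivity | eapply runs_cons; eassumption
    | exact: runs_zip].
- by [].
- by rewrite size_enumT; lia.
Qed.

Lemma runs_prune_call A p r env e1 e2 e3 b1 b2 b3 :
  runs env e1 (enc_set R A) b1 -> runs env e2 (row p) b2 ->
  runs env e3 (VReal r) b3 ->
  runs env (prune_call e1 e2 e3) (enc_set R (prune A p r))
    (b1 + b2 + b3 + N * 60 + 60).
Proof.
move=> h1 h2 h3; eapply runs_conv.
  eapply runs_call; [reflexivity | | ].
    eapply runs_cons; last by eapply runs_cons; [runs_step | exact: h3].
    by apply: runs_zip_call; [exact: h1 | exact: h2].
  eapply (@runs_fold 3 prune_step T (value R) _ id
    (fun y acc => VCons (enc_bool R ((y \in A) && (r < dst I p y))) acc)
    (enum T) VNil (VReal r) 13); first by [].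
  move=> x y xs w l rr; eapply runs_conv.
    repeat runs_step; eapply runs_ifle; [runs_step | runs_step | ].
    (* Value and bound are fixed before the case split, since both branches must agree on them. *)
    instantiate (2 := enc_bool R ((x \in A) && (r < dst I p x))).
    instantiate (1 := 1%N).
    rewrite ltNge; case: (dst I p x <= r) => /=.
      by rewrite andbF; apply: runs_nil.
    by rewrite andbT; apply: runs_var.
  - by [].
  - by [].
- rewrite /enc_set /enc_list; elim: (enum T) => //= x s ->.
  by rewrite inE.
- by rewrite size_enumT; lia.
Qed.

Lemma runs_diff_call (A B : {set T}) env e1 e2 b1 b2 :
  runs env e1 (enc_set R A) b1 -> runs env e2 (enc_set R B) b2 ->
  runs env (ECall 4 (ECons (zip_call e1 e2) (ECons ENil ENil)))
    (enc_set R (A :\: B)) (b1 + b2 + N * 60 + 60).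
Proof.
move=> h1 h2; eapply runs_conv.
  eapply runs_call; [reflexivity | | ].
    eapply runs_cons; last by eapply runs_cons; runs_step.
    by apply: runs_zip_call; [exact: h1 | exact: h2].
  eapply (@runs_fold 4 diff_step T (value R) _ id
    (fun y acc => VCons (enc_bool R (y \in A :\: B)) acc)
    (enum T) VNil VNil 13); first by [].
  move=> x y xs w l rr; rewrite inE; eapply runs_conv.
    eapply runs_match; [runs_step | eapply runs_cons; [ | runs_step]].
    instantiate (2 := enc_bool R ((x \notin B) && (x \in A))).
    instantiate (1 := 3%N).
    case: (x \in B) => /=; last first.
      by apply: (@runs_match_nil _ _ _ _ _ 1 1); runs_step.
    by apply: (@runs_match _ _ _ _ VNil VNil _ 1 1); runs_step.
  - by [].
  - by [].
- by rewrite /enc_set /enc_list; elim: (enum T) => //= x s ->.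
- by rewrite size_enumT; lia.
Qed.

Lemma runs_facilities s p z :
  runs [:: VCons (enc_list [seq VCons (row i) (VReal (dst I p i)) | i <- enum T])
     (VCons (enc_states z) (VCons (row p) (VCons (VReal delta) (enc_state s))))]
    (fold_expr 5 facility_step)
    (enc_states (foldr (fun i => cons (act s p i)) z (enum T)))
    (N * (N * 120 + 180) + 20).
Proof.
eapply runs_conv.
  eapply (@runs_fold 5 facility_step T (seq state) _ enc_states
    (fun i => cons (act s p i)) _ _ _ (N * 120 + 160)%N); first by [].
  move=> i acc xs w l r; eapply runs_conv.
    do 4 runs_step; eapply runs_cons; [eapply runs_cons | runs_step].
      eapply (@runs_prune_call _ p (delta * dst I p i)); repeat runs_step.
    eapply (@runs_prune_call _ i 0); repeat runs_step.
  - by [].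
  - by lia.
- by [].
- by rewrite size_enumT; lia.
Qed.

Lemma runs_centres s z :
  runs [:: VCons (enc_dst (dst I))
     (VCons (enc_states z)
       (VCons (enc_dst (dst I)) (VCons (VReal delta) (enc_state s))))]
    (fold_expr 6 centre_step)
    (enc_states (foldr (fun p acc =>
        foldr (fun i => cons (act s p i)) acc (enum T)) z (enum T)))
    (N * (N * (N * 120 + 200) + 100) + 20).
Proof.
eapply runs_conv.
  eapply (@runs_fold 6 centre_step T (seq state) row enc_states
    (fun p acc => foldr (fun i => cons (act s p i)) acc (enum T))
    _ _ _ (N * (N * 120 + 200) + 80)%N); first by [].
  move=> p acc xs w l r; eapply runs_conv.
    runs_step; eapply runs_call; [reflexivity | | exact: runs_facilities].
    eapply runs_cons; last by repeat runs_step.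
    eapply (@runs_zip_call row (fun i => VReal (dst I p i))); runs_step.
  - by [].
  - by lia.
- by [].
- by rewrite size_enumT; lia.
Qed.

(** Cubic: each pair of a centre and a facility costs two prunings linear in [N]. *)
Definition extend_time := (N * (N * (N * 120 + 200) + 100) + 60)%N.

Lemma runs_states ss :
  runs [:: VCons (enc_states ss)
     (VCons VNil (VCons (enc_dst (dst I)) (VReal delta)))]
    (fold_expr 7 state_step)
    (enc_states (step ss))
    (size ss * extend_time + 20).
Proof.
eapply runs_conv.
  eapply (@runs_fold 7 state_step state (seq state) enc_state enc_states
    extend ss [::] (VCons (enc_dst (dst I)) (VReal delta))
    (N * (N * (N * 120 + 200) + 100) + 40)%N); first by [].
  move=> s acc xs w l r; eapply runs_conv.
    runs_step; eapply runs_call; [reflexivity | | ].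
      by repeat runs_step.
    exact: (runs_centres s (s :: acc)).
  - by [].
  - by lia.
- by [].
- by rewrite /extend_time; lia.
Qed.

Lemma runs_counts s L :
  runs [:: VCons (VCons VNil (enc_set R s.1))
     (VCons (VCons (VReal 0) (enc_output L))
       (VCons (enc_set R s.1) (VCons (enc_set R (fac I :\: s.2))
         (enc_list (inst_fields I)))))]
    (fold_expr 8 count_step)
    (let mL := iter #|T|.+1 (count_up s) (0%N, L) in
      VCons (VReal mL.1%:R) (enc_output mL.2))
    (N * 70 + 90).
Proof.
(* Only the length of this list matters, so its elements are treated as raw values, encoded by
   [id]. *)
have -> : VCons VNil (enc_set R s.1) = enc_list
    (map id (VNil :: map (fun x => enc_bool R (x \in s.1)) (enum T))).
  by rewrite map_id.
eapply runs_conv.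
  eapply (@runs_fold 8 count_step (value R) (nat * seq (ext_instance R T)) id
    (fun mL => VCons (VReal mL.1%:R) (enc_output mL.2))
    (fun _ => count_up s) (VNil :: map (fun x => enc_bool R (x \in s.1)) (enum T))
    (0%N, L) (VCons (enc_set R s.1) (VCons (enc_set R (fac I :\: s.2))
         (enc_list (inst_fields I)))) 50); first by [].
  move=> x mL xs w l r; eapply runs_conv.
    by repeat runs_step.
  - by rewrite /= -[in RHS]addn1 natrD.
  - by [].
- rewrite /=.
  have -> : foldr (fun=> count_up s) (0%N, L)
    [seq enc_bool R (x \in s.1) | x <- enum T] = iter #|T| (count_up s) (0%N, L).
    by rewrite -/N -size_enumT; elim: (enum T) => //= x t ->.
  by [].
- by rewrite /= size_map size_enumT; lia.
Qed.

Lemma runs_emit ss :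
  runs [:: VCons (enc_states ss) (VCons VNil (enc_list (inst_fields I)))]
    (fold_expr 9 emit_step)
    (enc_output (foldr emit [::] ss))
    (size ss * (N * 130 + 230) + 20).
Proof.
eapply runs_conv.
  eapply (@runs_fold 9 emit_step state (seq (ext_instance R T)) enc_state
    (@enc_output R T) emit ss [::] (enc_list (inst_fields I))
    (N * 130 + 210)%N); first by [].
  move=> s L xs w l r; eapply runs_conv.
    do 2 runs_step; eapply runs_match; last by runs_step.
    eapply runs_call; [reflexivity | | exact: (runs_counts s L)].
    do 2 runs_step; first by runs_step.
    - by runs_step.
    - by repeat runs_step.
    - eapply runs_cons; [by runs_step | eapply runs_cons; last by runs_step].
      apply: runs_diff_call; runs_step.
  - by [].
  - by lia.
- by [].
- by lia.
Qed.

(** Each state contributes itself and one successor per pair [(p, i)]. *)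
Lemma size_step ss : size (step ss) = (size ss * (N ^ 2).+1)%N.
Proof.
have inner s p acc t : size (foldr (fun i => cons (act s p i)) acc t)
    = (size t + size acc)%N by elim: t => //= i t ->.
have outer s acc t : size (foldr (fun p acc =>
    foldr (fun i => cons (act s p i)) acc (enum T)) acc t)
    = (size t * N + size acc)%N.
  by elim: t => //= p t IH; rewrite inner IH size_enumT; lia.
elim: ss => //= s ss IH; rewrite /extend outer /= IH size_enumT; nia.
Qed.

Lemma size_iter_step k ss : size (iter k step ss) = (size ss * (N ^ 2).+1 ^ k)%N.
Proof.
elim: k => [|k IH] /=; first by rewrite expn0 muln1.
by rewrite size_step IH -mulnA; congr (_ * _)%N; rewrite [RHS]expnSr.
Qed.

(** [K] drives the induction, while [k] is the actual number of rounds: [k <= K] serves the time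
    bound and [x <= rho *+ k] the potential argument. *)
Lemma runs_iter (rho : R) K x ss : 0 < rho -> x <= rho *+ K ->
  exists k, [/\ (k <= K)%N, x <= rho *+ k &
    runs [:: VCons (VReal x) (VCons (VReal rho) (VCons (enc_states ss)
              (VCons (enc_dst (dst I)) (VReal delta))))] iter_body
      (enc_states (iter k step ss))
      (k * (size ss * (N ^ 2).+1 ^ k * extend_time + 60) + 20)].
Proof.
move=> rho0; elim: K x ss => [|K IH] x ss xK.
  exists 0%N; split=> //; eapply runs_conv.
    repeat runs_step; eapply runs_ifle; [runs_step | runs_step | ].
    by rewrite xK; runs_step.
  - by [].
  - by [].
have [x0|x0] := leP x 0.
  exists 0%N; split=> //; eapply runs_conv.
    repeat runs_step; eapply runs_ifle; [runs_step | runs_step | ].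
    by rewrite x0; runs_step.
  - by [].
  - by [].
have xK' : x - rho <= rho *+ K by rewrite lerBlDl -mulrS.
have [k [kK xk hk]] := IH _ (step ss) xK'.
exists k.+1; split=> //; first by rewrite mulrS -lerBlDl.
eapply runs_conv.
  repeat runs_step; eapply runs_ifle; [runs_step | runs_step | ].
  rewrite leNgt x0 /=; eapply runs_call; [reflexivity | | exact: hk].
  repeat runs_step.
  by eapply runs_call; [reflexivity | repeat runs_step | exact: runs_states].
- by rewrite -iterSr.
- have -> : (size (step ss) * (N ^ 2).+1 ^ k = size ss * (N ^ 2).+1 ^ k.+1)%N.
    by rewrite size_step -mulnA; congr (_ * _)%N; rewrite [RHS]expnS.
  (* The present round is charged at the size of the final list, which makes the bound uniform over
     the rounds. *)
  have : (size ss <= size ss * (N ^ 2).+1 ^ k.+1)%N.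
    by rewrite leq_pmulr // expn_gt0.
  move: (size ss * _)%N (extend_time) => X Y hX.
  have := leq_mul hX (leqnn Y); lia.
Qed.

Lemma runs_main rho U K : 0 < rho -> 8 <= rho *+ K ->
  exists k, [/\ (k <= K)%N, 8 <= rho *+ k &
    runs [:: enc_input I rho delta U] (ECall 0 (EVar 0))
      (enc_output (foldr emit [::] (iter k step [:: (cli I, fac I)])))
      (k * ((N ^ 2).+1 ^ k * extend_time + 60)
        + (N ^ 2).+1 ^ k * (N * 130 + 230) + 100)].
Proof.
move=> rho0 hK.
have [k [kK xk hk]] := runs_iter [:: (cli I, fac I)] rho0 hK.
exists k; split=> //; eapply runs_conv.
  eapply runs_call; [reflexivity | runs_step | ].
  do 6 runs_step.
  eapply runs_call; [reflexivity | |
    exact: (runs_emit (iter k step [:: (cli I, fac I)]))].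
  runs_step; last by repeat runs_step.
  by eapply runs_call; [reflexivity | repeat runs_step | exact: hk].
- by [].
- by rewrite size_iter_step /= !mul1n; lia.
Qed.

End Instance.
End Program.

(** * Enumerated instances and running time *)

Section Enumeration.
Variables (R : realType) (T : finType) (I : instance R T) (delta : R).

(** Rounds never lose a state, so a good state found early is still present at the end. *)
Lemma mem_step ss s : s \in ss ->
  s \in step I delta ss /\ forall p i, act I delta s p i \in step I delta ss.
Proof.
have inner x s' p acc t :
    x \in acc -> x \in foldr (fun i => cons (act I delta s' p i)) acc t.
  by move=> xa; elim: t => //= i t IH; rewrite inE IH orbT.
have outer x s' acc t : x \in acc -> x \in foldr (fun p acc =>
    foldr (fun i => cons (act I delta s' p i)) acc (enum T)) acc t.
  by move=> xa; elim: t => //= p t IH; apply: inner.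
elim: ss => //= s' ss IH; rewrite inE => /predU1P[->|/IH[h1 h2]]; last first.
  by split=> [|p i]; apply: outer; rewrite inE ?h1 ?h2 orbT.
split=> [|p i]; first by apply: outer; rewrite inE eqxx.
rewrite /extend; have : p \in enum T by rewrite mem_enum.
(* The skipped occurrence is the list of the inner loop, which must stay complete during the
   induction on the outer one. *)
elim: {1 3}(enum T) => //= p' t IHt; rewrite inE.
case/predU1P=> [<-|/IHt]; last exact: inner.
have : i \in enum T by rewrite mem_enum.
elim: {1 3}(enum T) => //= i' u IHu; rewrite !inE.
by case/predU1P=> [<-|/IHu ->]; rewrite ?eqxx ?orbT.
Qed.

Lemma mem_iter_step k s ss : s \in ss -> s \in iter k (step I delta) ss.
Proof. by move=> h; elim: k => //= k /mem_step[]. Qed.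

Lemma iter_count_up s L k :
  let mL := iter k (count_up I s) (0%N, L) in
  [/\ mL.1 = k, size mL.2 = (k + size L)%N &
   forall J, List.In J mL.2 <->
     (exists2 m, (m < k)%N & J = ext_of I s m) \/ List.In J L].
Proof.
elim: k => [|k [IH1 IH2 IH3]] /=.
  by split=> // J; split=> [|[[]|]] //; right.
split; [by rewrite IH1 | by rewrite IH2 | move=> J; split].
  case=> [<-|/IH3[[m mk ->]|]]; [| |by right]; left.
    by rewrite IH1; exists k.
  by exists m; rewrite // ltnS ltnW.
case=> [[m]|JL]; last by right; apply/IH3; right.
rewrite ltnS leq_eqVlt => /predU1P[-> ->|mk ->]; first by left; rewrite IH1.
by right; apply/IH3; left; exists m.
Qed.

Lemma In_emit ss J : List.In J (foldr (emit I) [::] ss) <->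
  exists s m, [/\ s \in ss, (m <= #|T|)%N & J = ext_of I s m].
Proof.
elim: ss => /= [|s ss IH]; first by split=> // -[s [m []]].
have [_ _ h] := iter_count_up s (foldr (emit I) [::] ss) #|T|.+1.
split=> [/h[[m mT ->]|/IH[s' [m [h1 h2 h3]]]]|].
- by exists s, m; rewrite inE eqxx.
- by exists s', m; rewrite inE h1 orbT.
- case=> s' [m [+ mT JE]]; rewrite inE => /predU1P[ss'|hs]; apply/h.
    by left; exists m; rewrite // -ss'.
  by right; apply/IH; exists s', m.
Qed.

Lemma size_emit ss : size (foldr (emit I) [::] ss) = (size ss * #|T|.+1)%N.
Proof.
elim: ss => //= s ss IH.
have [_ h _] := iter_count_up s (foldr (emit I) [::] ss) #|T|.+1.
by apply: (etrans h); rewrite IH mulSn.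
Qed.

(** The distance table alone has [#|T| ^ 2] real entries; hence the branching factor [(#|T| ^ 2).+1]
    is at most the input size. *)
Lemma vsize_enc_input (rho U : R) :
  (2 * #|T| ^ 2 + 2 * #|T| + 10 <= vsize (enc_input I rho delta U))%N.
Proof.
have enc_list_map (A : Type) (f : A -> value R) b s :
    (forall x, vsize (f x) = b) ->
    vsize (enc_list (map f s)) = (size s * b.+1).+1.
  by move=> h; elim: s => //= x s ->; rewrite h mulSn; lia.
have hd : vsize (enc_dst (dst I)) = (#|T| * (#|T| * 2).+2).+1.
  rewrite /enc_dst (enc_list_map _ _ (#|T| * 2).+1) ?size_enumT // => x.
  by rewrite (enc_list_map _ _ 1%N) ?size_enumT.
rewrite /= hd -mulnn; move: #|T| => m; nia.
Qed.

End Enumeration.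

(** The factors depending on [k] fit into [n ^ (2 * k)], and the polynomial cost per state into
    [n ^ 6]. *)
Lemma time_bound (T : finType) (n k : nat) (N := #|T|) : (2 * N ^ 2 + 2 * N + 10 <= n)%N ->
  (k * ((N ^ 2).+1 ^ k * extend_time T + 60)
        + (N ^ 2).+1 ^ k * (N * 130 + 230) + 100 <= n ^ (2 * k + 6))%N.
Proof.
rewrite -mulnn => hn.
have kn : (k <= n ^ k)%N.
  by apply/ltnW/ltn_expl; lia.
have Bn : ((N * N).+1 ^ k <= n ^ k)%N.
  by case: (k) => // k'; rewrite leq_exp2r //; lia.
have kB : (k * (N * N).+1 ^ k <= n ^ (2 * k))%N.
  by rewrite mul2n -addnn expnD leq_mul.
have B2 : ((N * N).+1 ^ k <= n ^ (2 * k))%N.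
  by apply: (leq_trans Bn); rewrite leq_exp2l //; lia.
have k2 : (k <= n ^ (2 * k))%N.
  by apply: (leq_trans kn); rewrite leq_exp2l //; lia.
have n1 : (1 <= n ^ (2 * k))%N by rewrite expn_gt0; lia.
have hE : (extend_time T + 130 * N + 500 <= n ^ 6)%N.
  rewrite /extend_time -/N.
  have h2 : (N * N <= n)%N by lia.
  have h3 : (N * N * N <= n * n)%N by apply: leq_mul => //; lia.
  have hn2 : (10 * n <= n * n)%N by rewrite leq_mul2r; apply/orP; right; lia.
  (* The cubic cost is of order [n * n]; the other four powers of [n >= 10] absorb the numerical
     coefficients. *)
  have hn4 : (1000 * (n * n) <= n ^ 6)%N.
    rewrite (_ : n ^ 6 = (n * n * n * n) * (n * n))%N; last by rewrite !expnS; lia.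
    rewrite leq_mul2r; apply/orP; right.
    apply: (@leq_trans (10 * 10 * 10 * 10)%N) => //.
    by do 3?[apply: leq_mul]; lia.
  lia.
rewrite expnD; move: (n ^ (2 * k))%N (n ^ 6)%N kB B2 k2 n1 hE => X Y kB B2 k2 n1 hE.
rewrite mulnDr mulnA.
nia.
Qed.

(** * Reaching a sparse state *)

Section Greedy.
Variables (R : realType) (q : nat) (T : finType) (I : instance R T).
Variables (rho delta U : R) (S Cs : {set T}) (kappa : T -> T).
Hypothesis q12 : q = 1%N \/ q = 2%N.
Hypothesis metric_d : metric_on [set: T]%SET (dst I).
Hypothesis delta_bounds : 0 < delta < 1 / 2.
Hypothesis S_fac : S \subset fac I.
Hypothesis kappa_mem : forall p, kappa p \in S.
Hypothesis kappa_min : forall p i, i \in S -> dst I (kappa p) p <= dst I i p.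

Let d := dst I.
(** The connection distance [c], real-valued because the minimum is attained at [kappa p]. *)
Let r (p : T) : R := d (kappa p) p.

Hypothesis cost_le : \sum_(j in Cs) r j ^+ q <= U.

Let d_ge0 x y : 0 <= d x y.
Proof. by have [h _ _ _] := metric_d; apply: h; rewrite inE. Qed.

Let d_eq0 x y : d x y = 0 <-> x = y.
Proof. by have [_ h _ _] := metric_d; apply: h; rewrite inE. Qed.

Let d_sym x y : d x y = d y x.
Proof. by have [_ _ h _] := metric_d; apply: h; rewrite inE. Qed.

Let d_tri x y z : d x z <= d x y + d y z.
Proof. by have [_ _ _ h] := metric_d; apply: h; rewrite inE. Qed.

(** The two sparsity bounds over the reals; [s.2] being the complement of [S_0] in the facilities,
    [i \in s.2] says that [i] is not yet forced. *)
Definition light (s : state T) : Prop :=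
  (forall i, i \in S -> i \in s.2 ->
     \sum_(j in Cs :&: s.1 | kappa j == i) r j ^+ q <= rho * U) /\
  (forall p, #|[set y in Cs :&: s.1 | (d p y <= delta * r p)%R]|%:R * r p ^+ q
     <= rho * U).

(* The last clause is d(j, S_0) <= (1 + delta) / (1 - delta) c_j for deleted j. *)
Definition consistent (s : state T) : Prop :=
  [/\ s.1 \subset cli I, fac I :\: s.2 \subset S &
   forall j, j \in Cs :\: s.1 ->
     exists2 i, i \in fac I :\: s.2 & (1 - delta) * d j i <= (1 + delta) * r j].

(** A dense ball lowers the first sum, a heavy star the second. *)
Definition potential (s : state T) : R :=
  \sum_(j in Cs | j \in s.1) r j ^+ q + \sum_(j in Cs | kappa j \in s.2) r j ^+ q.

Let r_ge0 p : 0 <= r p. Proof. exact: d_ge0. Qed.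

Let rq_ge0 p : 0 <= r p ^+ q. Proof. exact: exprn_ge0. Qed.

(** The facility nearest to [y] also competes for [p]: [r p <= d (kappa y) p <= r y + d y p]. *)
Lemma nearest_in_ball p y : d p y <= delta * r p -> (1 - delta) * r p <= r y.
Proof.
move=> hy; have h1 : r p <= d (kappa y) p by apply: kappa_min.
have h2 := d_tri (kappa y) y p; rewrite (d_sym y p) in h2.
rewrite -/(r y) in h2; nra.
Qed.

(** In a metric only [i] lies at distance 0 from [i], so the pruning routine with radius 0 forces a
    single facility. *)
Lemma prune_self (N : {set T}) i : prune I N i 0 = N :\ i.
Proof.
apply/setP=> y; rewrite !inE andbC lt_neqAle -/d d_ge0 andbT; congr (_ && _).
rewrite eq_sym; congr negb; apply/eqP/eqP => [/d_eq0 ->//|->].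
exact/d_eq0.
Qed.

Lemma act_nearest s p : act I delta s p (kappa p) =
  (s.1 :\: [set y | d p y <= delta * r p]%SET, s.2 :\ kappa p).
Proof.
rewrite /act prune_self; congr (_, _); apply/setP=> y.
by rewrite !inE -/d andbC -ltNge (d_sym p (kappa p)).
Qed.

Lemma consistent_act s p : consistent s ->
  consistent (act I delta s p (kappa p)).
Proof.
move=> [hC hS hj]; rewrite act_nearest; split=> /=.
- exact: fintype.subset_trans (subsetDl _ _) hC.
- apply/fintype.subsetP=> i; rewrite !inE negb_and negbK.
  case/andP=> /orP[/eqP-> _|iN iF]; first exact: kappa_mem.
  by apply: (fintype.subsetP hS); rewrite inE iN.
move=> j; rewrite !inE negb_and negbK => /andP[/orP[jp|jC] jCs].
  exists (kappa p).
    by rewrite !inE eqxx (fintype.subsetP S_fac).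
  (* A newly deleted [j] is served by [kappa p]: multiplying [d j (kappa p) <= (1 + delta) * r p] by
     [1 - delta] and using [h1] gives the bound without division. *)
  have h1 := nearest_in_ball jp.
  have h2 := d_tri j p (kappa p).
  rewrite (d_sym j p) (d_sym p (kappa p)) -/(r p) in h2.
  have := r_ge0 p; have := d_ge0 p j; case/andP: delta_bounds => *; nra.
(* A client deleted earlier keeps its facility, since [S_0] only grows. *)
have [|i iN hi] := hj j; first by rewrite inE jC.
exists i => //; move: iN; rewrite !inE => /andP[/negPf -> ->].
by rewrite andbF.
Qed.

(** The exact loss is the cost of the deleted ball plus that of the star of [kappa p]; the latter
    vanishes if [kappa p] is already forced. *)
Lemma potential_act s p : potential s = potential (act I delta s p (kappa p)) +
  (\sum_(j in Cs :&: s.1 | d p j <= delta * r p) r j ^+ q +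
   \sum_(j in Cs | (kappa j \in s.2) && (kappa j == kappa p)) r j ^+ q).
Proof.
rewrite act_nearest /potential /=.
have -> : \sum_(j in Cs | j \in s.1) r j ^+ q =
    \sum_(j in Cs :&: s.1 | d p j <= delta * r p) r j ^+ q +
    \sum_(j in Cs | j \in s.1 :\: [set y | d p y <= delta * r p]%SET) r j ^+ q.
  rewrite (bigID (fun j => d p j <= delta * r p)) /=.
  congr (_ + _); apply: eq_bigl => j; rewrite !inE //.
  by rewrite -andbA; congr (_ && _); rewrite andbC.
have -> : \sum_(j in Cs | kappa j \in s.2) r j ^+ q =
    \sum_(j in Cs | (kappa j \in s.2) && (kappa j == kappa p)) r j ^+ q +
    \sum_(j in Cs | kappa j \in s.2 :\ kappa p) r j ^+ q.
  rewrite (bigID (fun j => kappa j == kappa p)) /=.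
  congr (_ + _); apply: eq_bigl => j; rewrite ?inE -andbA //.
  by congr (_ && _); rewrite andbC.
lra.
Qed.

Lemma potential_ge0 s : 0 <= potential s.
Proof. by apply: addr_ge0; apply: sumr_ge0. Qed.

(** The worst case is [q = 2]; this is the source of the 4 in the decrease [rho * U / 4]. *)
Lemma half_pow : 1 / 4 <= (1 - delta) ^+ q.
Proof. by case/andP: delta_bounds; case: q12 => -> *; rewrite ?expr1 ?expr2; nra. Qed.

Lemma heavy_act s : 0 < rho -> 0 <= U -> ~ light s ->
  exists p, potential (act I delta s p (kappa p)) + rho * U / 4 < potential s.
Proof.
move=> rho0 U0 /not_andP[/existsNP[i]|/existsNP[p]].
  move=> /not_implyP[iS /not_implyP[iN /negP]]; rewrite -ltNge => hi.
  (* A facility of [S] is its own nearest one, so the step at [p = i] removes the star of [i]. *)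
  have ki : kappa i = i.
    apply/d_eq0/le_anti; rewrite d_ge0 andbT.
    by apply: le_trans (kappa_min i iS) _; rewrite -/d (iffRL (d_eq0 i i)).
  exists i; rewrite [ltRHS](potential_act _ i) ltrD2l ki.
  have h1 : 0 <= \sum_(j in Cs :&: s.1 | d i j <= delta * r i) r j ^+ q.
    exact: sumr_ge0.
  (* The potential counts whole stars, deleted clients included, hence drops by at least the
     surviving part. *)
  have h2 : \sum_(j in Cs :&: s.1 | kappa j == i) r j ^+ q <=
     \sum_(j in Cs | (kappa j \in s.2) && (kappa j == i)) r j ^+ q.
    rewrite [leLHS]big_mkcond [leRHS]big_mkcond; apply: ler_sum => j _ /=.
    rewrite inE; case: eqP => [->|]; last by rewrite !andbF.
    by rewrite iN /= !andbT; case: (j \in Cs) => //=; case: ifP.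
  have := mulr_ge0 (ltW rho0) U0; lra.
move=> /negP; rewrite -ltNge => hp.
exists p; rewrite [ltRHS](potential_act _ p) ltrD2l.
have h1 : 0 <= \sum_(j in Cs | (kappa j \in s.2) && (kappa j == kappa p)) r j ^+ q.
  exact: sumr_ge0.
(* Each client of the ball costs at least a quarter of [r p ^+ q], by [nearest_in_ball] and
   [half_pow]. *)
suff h2 : #|[set y in Cs :&: s.1 | (d p y <= delta * r p)%R]%SET|%:R * r p ^+ q * (1 / 4)
   <= \sum_(j in Cs :&: s.1 | d p j <= delta * r p) r j ^+ q.
  lra.
rewrite -mulrA mulr_natl -sumr_const.
rewrite [leRHS](eq_bigl (mem [set y in Cs :&: s.1 | d p y <= delta * r p]%SET)).
  apply: ler_sum => y; rewrite inE => /andP[_ /nearest_in_ball hy].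
  have hd : 0 <= 1 - delta by case/andP: delta_bounds => *; lra.
  apply: (@le_trans _ _ (((1 - delta) * r p) ^+ q)).
    by rewrite exprMn mulrC ler_wpM2r // half_pow.
  by rewrite lerXn2r // nnegrE // mulr_ge0.
by move=> y; rewrite /= inE.
Qed.

Lemma light_reached k : 0 < rho -> 8 <= rho *+ k -> Cs \subset cli I ->
  exists s, [/\ s \in iter k (step I delta) [:: (cli I, fac I)],
    consistent s & light s].
Proof.
move=> rho0 hk CsC.
have U0 : 0 <= U by apply: le_trans cost_le; apply: sumr_ge0.
have [s [hs inv_s [//|pot_s]]] : exists s,
   [/\ s \in iter k (step I delta) [:: (cli I, fac I)], consistent s &
    light s \/ potential s + (rho * U / 4) *+ k <= 2 * U].
- elim: {hk} k => [|k [s [hs inv_s ls]]].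
    exists (cli I, fac I); rewrite mem_seq1 eqxx; split=> //.
      split=> //=; first by rewrite finset.setDv finset.sub0set.
      by move=> j; rewrite inE => /andP[/negP jC /(fintype.subsetP CsC)].
    right; rewrite mulr0n addr0 /potential /= (_ : 2 * U = U + U); last by lra.
    apply: lerD; apply: le_trans cost_le; rewrite big_mkcondr /=;
      by apply: ler_sum => j _; case: ifP.
  have [hs' hact] := mem_step I delta hs.
  (* A light state is simply carried through the remaining rounds. *)
  have [lt|nl] := pselect (light s); first by exists s; split=> //; left.
  case: ls => // pot_s.
  have [p hp] := heavy_act rho0 U0 nl.
  exists (act I delta s p (kappa p)); split; [exact: hact|exact: consistent_act|].
  right; rewrite mulrS; lra.
- by move=> ls; exists s.
(* After [k] rounds the potential is at most 0, and one more strict decrease would make it negative;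
   strictness also covers [U = 0]. *)
have [lt|nl] := pselect (light s); first by exists s.
have [p hp] := heavy_act rho0 U0 nl.
have := potential_ge0 (act I delta s p (kappa p)).
have : (8 * U) <= (rho *+ k) * U by rewrite ler_wpM2r.
rewrite mulrnAl => h1; rewrite mulrnAl in pot_s.
have := mulr_ge0 (ltW rho0) U0.
rewrite -[(_ / 4) *+ k]mulrnAl in pot_s; lra.
Qed.

End Greedy.

(** * Extended-real costs *)

Lemma bigmine_min (R : realType) (T : finType) (S : {set T}) (f : T -> R) a :
  a \in S -> (forall i, i \in S -> f a <= f i) ->
  \big[mine/+oo%E]_(i in S) (f i)%:E = (f a)%:E.
Proof.
move=> aS ha; apply/le_anti/andP; split.
  by rewrite (bigD1 a) //= ge_min lexx.
apply: (big_ind (fun x => (f a)%:E <= x)%E) => [|x y hx hy|i iS].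
- exact: leey.
- by rewrite le_min hx.
- by rewrite lee_fin ha.
Qed.

Lemma dist_argmin (R : realType) (T : finType) (d : T -> T -> R) (S : {set T})
    j i : i \in S ->
  exists a, [/\ a \in S, d j a <= d j i & dist d j S = (d j a)%:E].
Proof.
move=> iS; case: (Order.TotalTheory.arg_minP (d j) iS) => a aS ha.
by exists a; split=> //; [exact: ha | exact: bigmine_min].
Qed.

(** Every distance to the empty set is infinite, so a finite cost leaves no client. This settles the
    case where [kappa] is unconstrained. *)
Lemma empty_solution_clients (R : realType) (q : nat) (T : finType)
    (I : instance R T) (Cs : {set T}) (U : R) : (0 < q)%N ->
  (cost q I finset.set0 Cs <= U%:E)%E -> Cs = finset.set0.
Proof.
move=> q0 hU; apply/eqP/finset.set0Pn => -[j jC].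
move: hU; rewrite /cost (eq_bigr (fun=> +oo%E)); last first.
  move=> i _; rewrite /dist big_pred0 => [|k]; last by rewrite inE.
  by case: q q0 => // q _; rewrite expeS; elim: q => [|q IH]; rewrite ?expe0 ?mule1 ?expeS ?IH.
rewrite (bigD1 j) //= addye //.
by rewrite gt_eqF // (@lt_le_trans _ _ 0%E) ?ltNy0 ?sume_ge0.
Qed.

(** * From real-valued bounds to sparsity over the extended reals *)

Section Final.
Variables (R : realType) (q : nat) (T : finType) (I : instance R T).
Variables (rho delta U : R).
Hypothesis fac_cli : fac I :|: cli I = [set: T]%SET.
Hypothesis wf_I : wf_instance I.
Hypothesis delta_bounds : 0 < delta < 1 / 2.

Let metric_d : metric_on [set: T]%SET (dst I).
Proof. by rewrite -fac_cli. Qed.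

Lemma light_sparse (S Cs : {set T}) (kappa : T -> T) (c : T -> \bar R)
    (s : state T) :
  let J := ext_of I s #|Cs :&: s.1| in
  solution I S Cs -> (cost q I S Cs <= U%:E)%E ->
  nearest_pair (dst I) (fac I :|: cli I) S kappa c -> S != finset.set0 ->
  consistent I delta S Cs kappa s -> light q I rho delta U S Cs kappa s ->
  sparse q J rho delta U S (Cs :&: cli J) kappa c /\
  (((1 - delta) ^+ q / (1 + delta) ^+ q)%:E *
     (\sum_(j in Cs :\: cli J) dist (dst I) j (forced J) ^+ q) +
   \sum_(j in Cs :&: cli J) dist (dst I) j S ^+ q <= U%:E)%E.
Proof.
move=> J [SF Sk CsC mC] hU near S0 [sC sS hj] [l1 l2].
pose d := dst I; pose r p := d (kappa p) p.
have [d_ge0 _ d_sym _] := metric_d.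
have inT (x : T) : x \in [set: T]%SET by rewrite inE.
have nearT p := near p (eq_ind_r (fun A : {set T} => p \in A) (inT p) fac_cli).
have kS p : kappa p \in S by have [/(_ S0)[]] := nearT p.
have kmin p i : i \in S -> d (kappa p) p <= d i p.
  by have [/(_ S0)[_ h] _] := nearT p; apply: h.
have r_ge0 p : 0 <= r p by apply: d_ge0.
have cr p : c p = (r p)%:E.
  have [_ ->] := nearT p.
  by apply: (bigmine_min (f := fun i => d i p)) => // i; apply: kmin.
have dr p : dist d p S = (r p)%:E.
  rewrite /dist (eq_bigr (fun i => (d i p)%:E)) => [|i _]; last by rewrite /d d_sym ?inT.
  by apply: (bigmine_min (f := fun i => d i p)) => // i; apply: kmin.
have dqA (A : {set T}) :
    (\sum_(j in A) dist d j S ^+ q = (\sum_(j in A) r j ^+ q)%:E)%E.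
  by rewrite -sumEFin; apply: eq_bigr => j _; rewrite dr EFin_expe.
have split_cost : \sum_(j in Cs :\: s.1) r j ^+ q +
    \sum_(j in Cs :&: s.1) r j ^+ q = \sum_(j in Cs) r j ^+ q.
  by rewrite [RHS](big_setID s.1) addrC.
have rq_ge0 j : 0 <= r j ^+ q by apply: exprn_ge0.
have hcost : \sum_(j in Cs) r j ^+ q <= U.
  by move: hU; rewrite /cost dqA lee_fin.
split.
  split.
  - by split=> //; split=> //; apply/fintype.subsetP=> x; rewrite inE => /andP[].
  - rewrite /cost dqA lee_fin; apply: le_trans hcost.
    by rewrite -split_cost lerDr sumr_ge0.
  - by move=> p _; apply: near; rewrite fac_cli.
  - move=> i; rewrite !inE negb_and negbK => /andP[/orP[iN|iF] iS]; last first.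
      by rewrite (fintype.subsetP SF) in iF.
    rewrite (eq_bigr (fun j => (r j ^+ q)%:E)); last first.
      by move=> j _; rewrite cr EFin_expe.
    by rewrite sumEFin lee_fin; apply: l1.
  - move=> p _; rewrite cr -EFin_expe -EFinM lee_fin.
    apply: le_trans (l2 p); rewrite ler_wpM2r //.
(* For (b) it suffices to bound the scaled cost of each deleted client by [r j ^+ q]; both sums then
   add up to the cost of [Cs]. *)
rewrite dqA; apply: (@le_trans _ _ (\sum_(j in Cs :\: s.1) r j ^+ q
    + \sum_(j in Cs :&: s.1) r j ^+ q)%:E); last by rewrite split_cost lee_fin.
rewrite EFinD leeD2r // -sumEFin ge0_sume_distrr; last first.
  by move=> j _; apply: expe_ge0; apply: (big_ind (fun x => 0 <= x)%E) => [|x y hx hy|i _];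
    rewrite ?leey ?le_min ?hx ?hy ?lee_fin ?d_ge0.
(* Consistency yields a forced facility near [j], which makes the distance to [S_0] finite. *)
apply: lee_sum => j /hj[i iS hi].
have [a [aS ai ->]] := dist_argmin d j iS.
rewrite -EFin_expe -EFinM lee_fin -expr_div_n -exprMn.
case/andP: delta_bounds => del0 del1.
have d1 : 0 < 1 + delta by lra.
have da : 0 <= d j a by apply: d_ge0.
apply: lerXn2r; rewrite ?nnegrE //.
  by rewrite !mulr_ge0 ?invr_ge0 //; lra.
rewrite mulrAC ler_pdivrMr // [leRHS]mulrC; apply: le_trans hi.
by rewrite ler_wpM2l //; lra.
Qed.

End Final.

(** * Assembling the time bound and the guarantee *)

Unset Implicit Arguments.
Set Strict Implicit.

Theorem theorem4 (R : realType) (q : nat) (hq : q = 1%N \/ q = 2%N) :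
  exists (P : program) (a : nat),
  forall (T : finType) (I : instance R T) (rho delta U : R),
    fac I :|: cli I = [set: T]%SET ->
    wf_instance I ->
    0 < rho < 1 / 2 ->
    0 < delta < 1 / 2 ->
    (exists S Cs : {set T}, optimal q I S Cs /\ (cost q I S Cs <= U%:E)%E) ->
    let n := vsize (enc_input I rho delta U) in
    exists (L : seq (ext_instance R T)) (t : nat),
      [/\ runs_in P (enc_input I rho delta U) (enc_output L) t,
          t%:R <= n%:R `^ (a%:R / rho),
          (size L)%:R <= n%:R `^ (a%:R / rho),
          forall J : ext_instance R T, List.In J L -> wf_ext J
        & forall (S Cs : {set T}) (kappa : T -> T) (c : T -> \bar R),
            optimal q I S Cs ->
            nearest_pair (dst I) (fac I :|: cli I) S kappa c ->
            exists J : ext_instance R T,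
              List.In J L /\
              [/\ fac J = fac I, dst J = dst I & kay J = kay I] /\
              [/\ cli J \subset cli I,
                  emm J = #|Cs :&: cli J|%:Z
                & forced J \subset S] /\
              sparse q J rho delta U S (Cs :&: cli J) kappa c /\
              (((1 - delta) ^+ q / (1 + delta) ^+ q)%:E *
                 (\sum_(j in Cs :\: cli J) dist (dst I) j (forced J) ^+ q) +
               \sum_(j in Cs :&: cli J) dist (dst I) j S ^+ q <= U%:E)%E].
Proof.
(* The exponent is at most [2 * K + 6 <= 16 / rho + 8], and [8 <= 4 / rho] because [rho < 1 / 2]. *)
exists prog, 20%N => T I rho delta U fac_cli wf_I /andP[rho0 rho1] del_bnd.
move=> [S1 [Cs1 [opt1 cost1]]] n.
have hn := vsize_enc_input I delta rho U; rewrite -/n in hn.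
pose K := (Num.truncn (8 / rho)).+1.
have r8 : 0 <= 8 / rho by rewrite divr_ge0 // ltW.
have K8 : 8 <= rho *+ K.
  have /ltW := truncnS_gt (8 / rho); rewrite -/K.
  by rewrite ler_pdivrMr // mulr_natl.
have K9 : K%:R <= 8 / rho + 1 :> R by rewrite /K -natr1 lerD2r truncn_le.
have [k [kK k8 [t run_t le_t]]] := runs_main I delta U rho0 K8.
set states := iter k _ _ in run_t.
have pow_le (m e : nat) : (m <= n ^ e)%N -> (e <= 2 * k + 6)%N ->
    m%:R <= n%:R `^ (20%:R / rho) :> R.
  move=> me ek; apply: (@le_trans _ _ (n ^ e)%:R); first by rewrite ler_nat.
  rewrite natrX -powR_mulrn //; apply: ler_powR; first by rewrite ler1n; lia.
  have : e%:R <= 2 * K%:R + 6 :> R.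
    by rewrite -!natrM -natrD ler_nat; apply: leq_trans ek _; lia.
  have : 2 <= rho^-1 by rewrite -[rho^-1]mul1r ler_pdivlMr //; lra.
  by move: (rho^-1) K9 => x; lra.
exists (foldr (emit I) [::] states), t; split.
- exact: run_t.
- by apply: (pow_le _ (2 * k + 6)%N) => //; apply: (leq_trans le_t); apply: time_bound.
- apply: (pow_le _ (k + 1)%N); last by lia.
  rewrite size_emit size_iter_step mul1n expnD expn1; apply: leq_mul; last by lia.
  by case: (k) => // k'; rewrite leq_exp2r //; lia.
- move=> J /In_emit[s [m [_ _ ->]]]; split; last exact: subsetDl.
  have [h1 h2 h3 h4] : metric_on [set: T]%SET (dst I) by rewrite -fac_cli.
  have inT (x : T) : x \in [set: T]%SET by rewrite inE.
  split=> /= [x y _ _|x y _ _|x y _ _|x y z _ _ _];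
    [exact: h1|exact: h2|exact: h3|exact: h4].
move=> S Cs kappa c opt near.
have [sol minS] := opt; have [SF Sk CsC mC] := sol.
(* The bound known for one optimal solution passes to every other. *)
have costS : (cost q I S Cs <= U%:E)%E.
  by apply: le_trans cost1; apply: minS; case: opt1.
suff [s [s_in [sC sS] fin]] : exists s : state T, [/\ s \in states,
    s.1 \subset cli I /\ fac I :\: s.2 \subset S &
    let J := ext_of I s #|Cs :&: s.1| in
    sparse q J rho delta U S (Cs :&: cli J) kappa c /\
    (((1 - delta) ^+ q / (1 + delta) ^+ q)%:E *
       (\sum_(j in Cs :\: cli J) dist (dst I) j (forced J) ^+ q) +
     \sum_(j in Cs :&: cli J) dist (dst I) j S ^+ q <= U%:E)%E].
  (* The right value of [m'] is at most [#|T|], hence among the guesses. *)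
  exists (ext_of I s #|Cs :&: s.1|); split.
    by apply/In_emit; exists s, #|Cs :&: s.1|; split=> //; apply: max_card.
  by case: fin.
(* If [S] is empty then so is [Cs], and the initial state, with no forced facility and all clients,
   already works. *)
have [S0|S0] := eqVneq S finset.set0.
  have q0 : (0 < q)%N by case: hq => ->.
  have Cs0 : Cs = finset.set0.
    by apply: (empty_solution_clients (I := I) (U := U) q0); rewrite -S0.
  have U0 : 0 <= U by move: costS; rewrite Cs0 /cost big_set0 lee_fin.
  exists (cli I, fac I); split.
  - by apply: mem_iter_step; rewrite mem_seq1.
  - by rewrite /= finset.setDv finset.sub0set.
  rewrite /= Cs0 finset.set0I finset.set0D !big_set0 mule0 adde0 lee_fin; split=> //.
  split.
  - split; rewrite /= ?finset.setDv ?finset.sub0set //.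
    by split; rewrite ?finset.sub0set ?cards0.
  - by rewrite /cost big_set0 lee_fin.
  - exact: near.
  - by move=> i; rewrite S0 !inE andbF.
  - move=> p _; rewrite (_ : ball_in _ _ _ _ = finset.set0); last first.
      by apply/setP=> y; rewrite !inE.
    by rewrite cards0 mul0e lee_fin mulr_ge0 // ltW.
have inFC p : p \in fac I :|: cli I by rewrite fac_cli inE.
have kS p : kappa p \in S by have [/(_ S0)[]] := near p (inFC p).
have kmin p i : i \in S -> dst I (kappa p) p <= dst I i p.
  by have [/(_ S0)[_ h] _] := near p (inFC p); apply: h.
have metric_d : metric_on [set: T]%SET (dst I) by rewrite -fac_cli.
have hcost : \sum_(j in Cs) dst I (kappa j) j ^+ q <= U.
  have [_ _ d_sym _] := metric_d.
  move: costS; rewrite /cost (eq_bigr (fun j => (dst I (kappa j) j ^+ q)%:E)).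
    by rewrite sumEFin lee_fin.
  move=> j _; rewrite d_sym ?inE // EFin_expe; congr (_ ^+ _)%E.
  apply: (bigmine_min (f := fun i => dst I j i)) => // i iS.
  by rewrite (d_sym j) ?inE // (d_sym j) ?inE // kmin.
have [s [s_in cons_s light_s]] := light_reached hq metric_d del_bnd SF kS kmin
  hcost rho0 k8 CsC.
exists s; split=> //; first by case: cons_s.
exact: (light_sparse fac_cli wf_I del_bnd sol costS near S0 cons_s light_s).
Qed.
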